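(* Let $d\geq 3$ be an odd integer and consider the reduced plane curve $V:f=0$ of degree $d$ in $\mathbb{P}^2$ (over $\mathbb{C}$) given by $$f=x^d+y^d+z^d-(x+y+z)^d.$$ Then the curve $V$ has exactly $3(d-2)$ singularities, all of type $A_1$ (nodes), located at the points $p=(1:u:-u)$, $p'=(u:1:-u)$ and $p''=(u:-u:1)$, where $u\in\mathbb{C}$ satisfies $u^{d-1}=1$. Moreover, for $d\geq 5$, the curve $V$ has four irreducible components, namely the three lines $x+y=0$, $x+z=0$ and $y+z=0$, and a smooth curve of degree $d-3$ meeting each of these three lines in $d-3$ points, distinct from the vertices of the triangle $(x+y)(x+z)(y+z)=0$. *)

(* Defs.v *)
From HB Require Import structures.
From mathcomp Require Import all_boot all_order all_algebra.
From mathcomp Require Export complex.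
From mathcomp Require Export mpoly.
From mathcomp Require Export reals.
Set Implicit Arguments.
Unset Strict Implicit.
Unset Printing Implicit Defensive.
Import Order.TTheory GRing.Theory Num.Theory.
Local Open Scope ring_scope.

Definition Cplx (R : realType) : numClosedFieldType :=
  Num.ClosedField.clone (complex R) _.

(* Points of the projective plane over K: the lines through the origin of K^3. *)
Definition P2 (K : fieldType) := {L : {vspace 'rV[K]_3} | \dim L == 1%N}.

Definition vec3 (K : fieldType) (a b c : K) : 'rV[K]_3 :=
  \row_(j < 3) [:: a; b; c]`_j.

(* [P] has homogeneous coordinates (a : b : c).  As [P] has dimension 1, this
   forces (a, b, c) to be nonzero. *)
Definition has_coords (K : fieldType) (P : P2 K) (a b c : K) : Prop :=
  val P = <[vec3 a b c]>%VS.

(* Plane curves are given by their (homogeneous) equations. *)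
Definition on_curve (K : fieldType) (f : {mpoly K[3]}) (P : P2 K) : Prop :=
  forall v : 'rV[K]_3, v \in val P -> f.@[v 0] = 0.

Definition singular_at (K : fieldType) (f : {mpoly K[3]}) (P : P2 K) : Prop :=
  on_curve f P /\ forall i : 'I_3, on_curve f^`M(i) P.

Definition smooth_curve (K : fieldType) (f : {mpoly K[3]}) : Prop :=
  forall P : P2 K, ~ singular_at f P.

Definition has_exactly (K : fieldType) (n : nat) (A : P2 K -> Prop) : Prop :=
  exists s : seq (P2 K), [/\ uniq s, size s = n & forall P, P \in s <-> A P].

(* Formal power series in n variables, as coefficient functions. *)
Definition pseries (K : fieldType) (n : nat) := 'X_{1..n} -> K.

Definition ps_add (K : fieldType) (n : nat) (a b : pseries K n) : pseries K n :=
  fun m => a m + b m.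

Definition ps_mul (K : fieldType) (n : nat) (a b : pseries K n) : pseries K n :=
  fun m => \sum_(k : 'X_{1..n < (mdeg m).+1} | (k <= m)%MM) a k * b (m - k)%MM.

(* Convergence on a neighbourhood of 0 (Cauchy estimates); the bound at m = 0
   forces M to be real and nonnegative. *)
Definition ps_convergent (K : numFieldType) (n : nat) (a : pseries K n) : Prop :=
  exists M : K, forall m, `|a m| <= M ^+ (mdeg m).+1.

(* (a, b) is a system of local analytic coordinates at the origin of K^2:
   both vanish at 0 and their Jacobian determinant at 0 is nonzero. *)
Definition local_coords (K : numFieldType) (a b : pseries K 2) : Prop :=
  [/\ ps_convergent a, ps_convergent b, a 0%MM = 0, b 0%MM = 0 &
      a U_(0%R)%MM * b U_(1%R)%MM - a U_(1%R)%MM * b U_(0%R)%MM != 0].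

(* The germ at the origin of the affine curve F = 0 is analytically equivalent
   to the normal form a^2 + b^2 = 0: F = e (a^2 + b^2) with (a, b) local analytic
   coordinates and e an invertible convergent power series. *)
Definition A1_germ (K : numFieldType) (F : {mpoly K[2]}) : Prop :=
  exists a b e : pseries K 2,
    [/\ local_coords a b, ps_convergent e, e 0%MM != 0 &
        forall m, F@_m = ps_mul e (ps_add (ps_mul a a) (ps_mul b b)) m].

(* Equation of f in the affine chart x_i = 1, the point (v_j / v_i)_(j != i)
   being translated to the origin. *)
Definition local_eq (K : fieldType) (i : 'I_3) (v : 'rV[K]_3)
    (f : {mpoly K[3]}) : {mpoly K[2]} :=
  f \mPo [tuple if unlift i j is Some k then 'X_k + (v 0 j / v 0 i)%:MP else 1
         | j < 3].

Definition type_A1_at (K : numFieldType) (f : {mpoly K[3]}) (P : P2 K) : Prop :=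
  exists i : 'I_3, exists v : 'rV[K]_3,
    [/\ v \in val P, v 0 i != 0 & A1_germ (local_eq i v f)].

Definition divides (K : fieldType) (g f : {mpoly K[3]}) : Prop :=
  exists q, f = q * g.

Definition irreducible (K : fieldType) (g : {mpoly K[3]}) : Prop :=
  [/\ g != 0, g \isn't a GRing.unit &
      forall p q, g = p * q -> (p \is a GRing.unit) || (q \is a GRing.unit)].

Definition squarefree (K : fieldType) (f : {mpoly K[3]}) : Prop :=
  forall g, divides (g ^+ 2) f -> g \is a GRing.unit.

Definition reduced_plane_curve (K : fieldType) (d : nat) (f : {mpoly K[3]}) :
    Prop :=
  [/\ f != 0, f \is d.-homog & squarefree f].

(* Equations define the same curve when they are proportional. *)
Definition same_curve (K : fieldType) (g h : {mpoly K[3]}) : Prop :=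
  exists2 c : K, c != 0 & g = c *: h.

Definition irr_component (K : fieldType) (f g : {mpoly K[3]}) : Prop :=
  irreducible g /\ divides g f.

(* The irreducible components of f = 0 are the curves in s, without repetition. *)
Definition irr_components (K : fieldType) (f : {mpoly K[3]})
    (s : seq {mpoly K[3]}) : Prop :=
  (forall i j : 'I_(size s), same_curve s`_i s`_j -> i = j) /\
  (forall g, irr_component f g <-> exists2 h, h \in s & same_curve g h).

Definition varx (K : fieldType) : {mpoly K[3]} := 'X_0.
Definition vary (K : fieldType) : {mpoly K[3]} := 'X_1.
Definition varz (K : fieldType) : {mpoly K[3]} := 'X_2.

Definition curveV (K : fieldType) (d : nat) : {mpoly K[3]} :=
  varx K ^+ d + vary K ^+ d + varz K ^+ d - (varx K + vary K + varz K) ^+ d.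

Definition three_lines (K : fieldType) : seq {mpoly K[3]} :=
  [:: varx K + vary K; varx K + varz K; vary K + varz K].

Definition triangle_vertex (K : fieldType) (P : P2 K) : Prop :=
  exists l1 l2, [/\ l1 \in three_lines K, l2 \in three_lines K, l1 != l2,
                    on_curve l1 P & on_curve l2 P].

(* Main.v *)
From HB Require Import structures.
Require Import Defs.
From mathcomp Require Import all_boot all_order all_algebra.
From mathcomp Require Import separable cyclotomic.
From mathcomp Require Import ring zify.
Import GRing.Theory.
Local Open Scope ring_scope.

(** Let [S] be the sum of the three variables.

    Singular points.  The partial derivatives of [f] are [d (X_i^(d-1) - S^(d-1))],
    so at a singular point the three coordinates and their sum [s] have equal
    [(d-1)]-th powers, hence equal moduli.  Complex conjugation turns
    [x + y + z = s] into [1/x + 1/y + 1/z = 1/s], and this says exactly that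
    [(x + y)(x + z)(y + z) = 0] ([equal_powers_sum]).  On each of the three lines
    the equation then reduces to [u^(d-1) = 1], and the three families of [d - 1]
    points overlap in the three vertices of the triangle.

    Nodes.  As [d] is odd, [f] is the product of [x_j + x_k] and an explicit
    cofactor ([curve_factor]).  At a singular point on this line both factors
    vanish, and the second derivatives of [f] show that their gradients are
    independent ([cofactor_tangent]).  A product [l g] of two transverse branches
    is [((l + g)/2)^2 + ((l - g)/(2i))^2], which is the normal form of a node with
    polynomial coordinates ([A1_germ_crossing]).

    Components.  Linear forms are prime, so [f] is the product of the three linear
    forms and a polynomial [g].  A singular point of [g], or a vertex of the
    triangle on [g], would be one of the points above at which the cofactor of a
    line has zero gradient; so [g] is smooth and avoids the vertices.  Its trace on
    a line is read off from the restriction [d (b^(d-1) - a^(d-1))] of the cofactor.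
    Finally a smooth plane curve is irreducible: two factors would meet
    ([common_zero]) and [g] would be singular there ([nonsingular_irreducible]).
    The intersection point comes from eliminating the last variable: the resultant
    is a polynomial in two variables that vanishes at the origin, and a zero of
    such a polynomial is never isolated ([affine_zero_not_isolated]).

    Reducedness.  The square of a factor [h] of [f] makes [h] divide all the
    partial derivatives, hence all the differences [X_i^(d-1) - X_j^(d-1)]; no
    variable occurs in all their leading monomials ([curve_squarefree]). *)

Set Implicit Arguments.
Unset Strict Implicit.
Unset Printing Implicit Defensive.
Import Order.TTheory Num.Theory.

(** * Homogeneous polynomials and their factors *)

Section Homogeneous.
Variables (n : nat) (K : fieldType).
Implicit Types (p q : {mpoly K[n]}) (v : 'I_n -> K).

(** Replacing each variable [X_i] by [X_i T] records degrees as powers of [T].  It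
    is a ring morphism into univariate polynomials over a domain, so it reduces
    questions on the degrees of factors to one variable. *)
Definition graded p : {poly {mpoly K[n]}} :=
  mmap (polyC \o @mpolyC n K) (fun i => ('X_i)%:P * 'X) p.

Lemma graded0 : graded 0 = 0. Proof. exact: mmap0. Qed.

Lemma gradedD : {morph graded : p q / p + q}. Proof. exact: mmapD. Qed.

Lemma gradedM : {morph graded : p q / p * q}.
Proof. by move=> p q; rewrite /graded rmorphM. Qed.

Lemma gradedX m : graded 'X_[m] = ('X_[m])%:P * 'X^(mdeg m).
Proof.
rewrite /graded mmapX /mmap1.
under eq_bigr do rewrite exprMn.
rewrite big_split /= prodrXr -mdegE -[in RHS]mmap1_id /mmap1 rmorph_prod.
by under [in RHS]eq_bigr do rewrite rmorphXn.
Qed.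

Lemma gradedZ c p : graded (c *: p) = c%:MP%:P * graded p.
Proof. exact: mmapZ. Qed.

Lemma coef_graded p k : (graded p)`_k = pihomog mdeg k p.
Proof.
elim/mpolyind: p => [|c m p _ _ IH]; first by rewrite graded0 coef0 pihomog0.
rewrite gradedD coefD pihomogD; congr (_ + _); last exact: IH.
rewrite gradedZ gradedX linearZ /= pihomogX.
rewrite mulrA -rmorphM coefCM coefXn mul_mpolyC eq_sym.
by case: eqP; rewrite ?mulr1 ?mulr0 ?scaler0.
Qed.

Lemma graded_dhomog d p : (p \is d.-homog) <-> graded p = p%:P * 'X^d.
Proof.
split=> [hp|hp].
  apply/polyP => k; rewrite coef_graded coefCM coefXn.
  have [->|kd] := eqVneq; first by rewrite mulr1 pihomog_dE.
  by rewrite mulr0 (@pihomog_ne0 _ _ _ d) // eq_sym.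
by rewrite homog_piE -coef_graded hp coefCM coefXn eqxx mulr1.
Qed.

Lemma dhomog_divl k l p q : p != 0 -> p \is k.-homog ->
  p * q \is (k + l).-homog -> q \is l.-homog.
Proof.
move=> p0 /graded_dhomog hp /graded_dhomog; rewrite gradedM hp => e.
apply/graded_dhomog.
have h : (p%:P : {poly {mpoly K[n]}}) * 'X^k != 0.
  by rewrite mulf_neq0 ?polyC_eq0 // monic_neq0 ?monicXn.
by apply: (mulfI h); rewrite e exprD rmorphM /=; ring.
Qed.

Lemma meval_zero p : p.@[fun=> 0] = p@_0.
Proof.
elim/mpolyind: p => [|c m p _ _ IH]; first by rewrite meval0 mcoeff0.
rewrite mevalD mcoeffD; congr (_ + _); last exact: IH.
rewrite mevalZ mcoeffZ mevalX mcoeffX; congr (_ * _).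
have [->|m0] := eqVneq m 0%MM; first by rewrite big1 // => i _; rewrite mnm0E expr0.
case: (pickP (fun i => m i != 0%N)) => [i mi|mi].
  by rewrite (bigD1 i) //= expr0n (negPf mi) mul0r.
by case/eqP: m0; apply/mnmP => i; rewrite mnm0E; move/negbFE/eqP: (mi i).
Qed.

Lemma dhomog_scale d p v c : p \is d.-homog ->
  p.@[fun i => c * v i] = c ^+ d * p.@[v].
Proof.
move/dhomogP => hp; rewrite !mevalE mulr_sumr big_seq [RHS]big_seq.
apply: eq_bigr => m /hp dm; rewrite mulrCA; congr (_ * _).
under eq_bigr do rewrite exprMn.
by rewrite big_split /= prodrXr -mdegE dm.
Qed.

Lemma dhomog_deriv d p i : p \is d.+1.-homog -> p^`M(i) \is d.-homog.
Proof.
move/dhomogP => hp; apply/dhomogP => m.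
rewrite mcoeff_msupp mcoeff_deriv => h.
have : (m + U_(i))%MM \in msupp p.
  by rewrite mcoeff_msupp; apply: contraNneq h => ->; rewrite mul0rn.
by move/hp; rewrite /= mdegD mdeg1 addn1 => -[].
Qed.

Lemma msize1_unit p : msize p = 1%N -> p \is a GRing.unit.
Proof.
move/eqP/msize_poly1P => [c c0 ->].
by apply: (rmorph_unit (@mpolyC n K)); rewrite unitfE.
Qed.

Lemma unit_msize1 p : p \is a GRing.unit -> msize p = 1%N.
Proof.
move=> up; have : msize (p * p^-1) = 1%N by rewrite divrr // msize1.
have p0 : p != 0 by apply: contraTneq up => ->; rewrite unitr0.
have q0 : p^-1 != 0 by rewrite invr_eq0.
rewrite msizeM // (mpolySpred _ p0) (mpolySpred _ q0) addnS /= => -[].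
by move/eqP; rewrite addn_eq0 => /andP[/eqP -> _].
Qed.

Lemma coef0_graded p : (graded p)`_0 = (p@_0)%:MP.
Proof.
elim/mpolyind: p => [|c m p _ _ IH]; first by rewrite graded0 coef0 mcoeff0.
rewrite gradedD coefD mcoeffD rmorphD; congr (_ + _); last exact: IH.
rewrite gradedZ gradedX mulrA -rmorphM coefCM coefXn mcoeffZ mcoeffX.
by rewrite eq_sym mdeg_eq0; case: eqP => [->|_]; rewrite ?mpolyX0 ?mulr1 ?mulr0.
Qed.

Lemma graded_eval p : (graded p).[1] = p.
Proof.
elim/mpolyind: p => [|c m p _ _ IH]; first by rewrite graded0 horner0.
rewrite gradedD hornerD; congr (_ + _); last exact: IH.
rewrite gradedZ gradedX !hornerM !hornerC hornerXn.
by rewrite expr1n mulr1 mul_mpolyC.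
Qed.

(** [T] is prime and does not divide [P], so all the factors [T] sit in [Q]. *)
Lemma Xn_factor (D : idomainType) k (P Q : {poly D}) c : P`_0 != 0 ->
  P * Q = c%:P * 'X^k -> exists Q', P * Q' = c%:P.
Proof.
move=> P0; elim: k Q => [|k IH] Q; first by rewrite expr0 mulr1; exists Q.
move=> e; have : (P * Q).[0] = 0 by rewrite e exprSr mulrA hornerMX mulr0.
rewrite hornerM -!horner_coef0 in P0 *.
move/eqP; rewrite mulf_eq0 (negPf P0) /= => /factor_theorem [Q1 Q1E].
apply: (IH Q1); apply: (@mulIf _ 'X); first by rewrite polyX_eq0.
by rewrite -mulrA -[RHS]mulrA -exprSr -e Q1E subr0.
Qed.

(** [graded p] divides a monomial in [T] and has a nonzero constant term, so it is
    constant in [T]: then [p] is homogeneous of degree 0. *)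
Lemma dhomog_factor_unit d p q : p * q != 0 -> p * q \is d.-homog ->
  p.@[fun=> 0] != 0 -> p \is a GRing.unit.
Proof.
move=> pq0 /graded_dhomog; rewrite meval_zero gradedM => e p0.
have [|Q' PQ] := Xn_factor _ e; first by rewrite coef0_graded mpolyC_eq0.
have sP : size (graded p) = 1%N.
  have : size (graded p * Q') = 1%N by rewrite PQ size_polyC pq0.
  have h : graded p * Q' != 0 by rewrite PQ polyC_eq0.
  move: h; rewrite mulf_eq0 negb_or => /andP[h1 h2].
  rewrite size_mul // => /eqP.
  move: h1 h2; rewrite -!size_poly_gt0.
  by case: (size (graded p)) (size Q') => [|[|a]] [|b] //; rewrite addnS.
apply: msize1_unit; apply/eqP/msize_poly1P; exists p@_0 => //.
rewrite -{1}(graded_eval p) (size1_polyC (eq_leq sP)) hornerC.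
exact: coef0_graded.
Qed.

End Homogeneous.

(** * Common zeros of two ternary polynomials *)

Lemma mmap_comp n (R : nzRingType) (S T : comNzRingType) (h : 'I_n -> S)
    (f : {rmorphism R -> S}) (g : {rmorphism S -> T}) (p : {mpoly R[n]}) :
  g (mmap f h p) = mmap (g \o f) (g \o h) p.
Proof.
rewrite /mmap rmorph_sum; apply: eq_bigr => m _.
by rewrite rmorphM rmorph_prod; congr (_ * _); apply: eq_bigr => i _; rewrite rmorphXn.
Qed.

Section CommonZero.
Variable F : closedFieldType.

(** If [r(0,1)] is not zero then [r(x,0) - r(x,1)] is a nonzero polynomial in [x].
    At some nonzero [x] where it does not vanish, [r(x,y)] is a nonconstant
    polynomial in [y] and has a root. *)
Lemma affine_zero_not_isolated (r : {poly {poly F}}) : r.[0].[0] = 0 ->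
  exists x y, ((x != 0) || (y != 0)) /\ r.[x%:P].[y] = 0.
Proof.
move=> r00.
have [r01|r01] := eqVneq r.[0].[1] 0.
  by exists 0, 1; rewrite oner_neq0 orbT polyC0.
pose D := map_poly (horner_eval 0) r - map_poly (horner_eval 1) r.
have DE x : D.[x] = r.[x%:P].[0] - r.[x%:P].[1].
  have e y : (map_poly (horner_eval y) r).[x] = r.[x%:P].[y].
    by rewrite -{1}(hornerC x y) -[_.[y] in LHS]/(horner_eval y _) horner_map.
  by rewrite hornerD hornerN !e.
have D0 : D.[0] != 0 by rewrite DE polyC0 r00 sub0r oppr_eq0.
have XD0 : 'X * D != 0.
  by rewrite mulf_neq0 ?polyX_eq0 //; apply: contraNneq D0 => ->; rewrite horner0.
have /closed_nonrootP[x] := XD0.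
rewrite /root hornerM hornerX mulf_eq0 negb_or DE subr_eq0 => /andP[x0 rx].
have : size r.[x%:P] != 1%N.
  by apply: contraNneq rx => /eq_leq/size1_polyC ->; rewrite !hornerC.
case/closed_rootP => y /rootP ry; exists x, y; split=> //.
by rewrite x0.
Qed.

(** The nesting is [F[y][x][z]]: the outermost variable is the one to eliminate. *)
Definition poly_in_z (p : {mpoly F[3]}) : {poly {poly {poly F}}} :=
  mmap (polyC \o (polyC \o polyC))
    (fun i => [:: 'X%:P; 'X%:P%:P; 'X]`_i) p.

Lemma poly_in_zM : {morph poly_in_z : p q / p * q}.
Proof. by move=> p q; rewrite /poly_in_z rmorphM. Qed.

Definition at_xy x y : {rmorphism {poly {poly F}} -> F} :=
  horner_eval y \o horner_eval x%:P.

Lemma poly_in_z_eval p (v : 'rV[F]_3) :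
  (map_poly (at_xy (v 0 0) (v 0 1)) (poly_in_z p)).[v 0 2] = p.@[v 0].
Proof.
set f := at_xy _ _.
rewrite -[LHS]/((horner_eval (v 0 2) \o map_poly f) (poly_in_z p)).
rewrite /poly_in_z mmap_comp /meval /mmap; apply: eq_bigr => m _; congr (_ * _).
  rewrite -[LHS]/((map_poly f ((p@_m)%:P)%:P%:P).[v 0 2]).
  by rewrite map_polyC hornerC /= /horner_eval !hornerC.
apply: eq_bigr => i _; congr (_ ^+ _).
rewrite -[LHS]/((map_poly f [:: 'X%:P; 'X%:P%:P; 'X]`_i).[v 0 2]).
case: i => [[|[|[|i]]] Hi] //=; rewrite ?map_polyC ?map_polyX ?hornerC ?hornerX;
  rewrite /= /horner_eval ?hornerC ?hornerX ?hornerC; by congr (v _ _); apply: val_inj.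
Qed.

Lemma resultant_common_root (p q : {poly F}) : p != 0 ->
  resultant p q = 0 <-> exists z, p.[z] = 0 /\ q.[z] = 0.
Proof.
move=> p0; rewrite (rwP eqP) resultant_eq0; split=> [sg|[z [pz qz]]].
  have /closed_rootP[z] : size (gcdp p q) != 1%N by rewrite neq_ltn sg orbT.
  by rewrite root_gcd => /andP[/rootP pz /rootP qz]; exists z.
have : 'X - z%:P %| gcdp p q by rewrite dvdp_XsubCl root_gcd !rootE pz qz eqxx.
by move/dvdp_leq; rewrite size_XsubC; apply; rewrite gcdp_eq0 negb_and p0.
Qed.

(** The leading coefficients in [z] being units, the resultant specialises at
    every [(x, y)], and it vanishes exactly below the common zeros.  It vanishes
    at the origin because [p] and [q] do, hence at another point too. *)
Lemma common_zero (p q : {mpoly F[3]}) :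
    lead_coef (poly_in_z p) \is a GRing.unit ->
    lead_coef (poly_in_z q) \is a GRing.unit ->
    p.@[fun=> 0] = 0 -> q.@[fun=> 0] = 0 ->
  exists v : 'rV[F]_3, [/\ v != 0, p.@[v 0] = 0 & q.@[v 0] = 0].
Proof.
move=> up uq p0 q0; pose r := resultant (poly_in_z p) (poly_in_z q).
have lead_nz x y (h : {poly {poly {poly F}}}) : lead_coef h \is a GRing.unit ->
    at_xy x y (lead_coef h) != 0.
  by move=> uh; rewrite -unitfE rmorph_unit.
have fiber x y : r.[x%:P].[y] = 0 <-> exists z,
    (map_poly (at_xy x y) (poly_in_z p)).[z] = 0 /\
    (map_poly (at_xy x y) (poly_in_z q)).[z] = 0.
  have e := map_resultant (lead_nz x y _ up) (lead_nz x y _ uq).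
  rewrite -resultant_common_root; last first.
    by rewrite -lead_coef_eq0 lead_coef_map_eq lead_nz.
  by move: e; rewrite -/r => <-.
have r00 : r.[0].[0] = 0.
  have e h : h.@[fun=> 0] = 0 -> (map_poly (at_xy 0 0) (poly_in_z h)).[0] = 0.
    move=> h0; have := poly_in_z_eval h 0; rewrite !mxE => ->.
    by rewrite -h0; apply: meval_eq => i; rewrite mxE.
  by rewrite -[X in r.[X]]polyC0; apply/fiber; exists 0; split; apply: e.
have [x [y [xy0 /fiber[z [pz qz]]]]] := affine_zero_not_isolated r00.
have e h : (map_poly (at_xy x y) (poly_in_z h)).[z] = h.@[vec3 x y z 0].
  by rewrite -poly_in_z_eval !mxE.
exists (vec3 x y z); rewrite -[p.@[_]]e -[q.@[_]]e; split=> //.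
apply: contraTneq xy0 => /rowP v0.
have := v0 0; have := v0 1; rewrite !mxE /= => -> ->.
by rewrite eqxx.
Qed.

End CommonZero.

(** * Irreducibility of smooth curves *)

Section Irreducible.
Variable F : closedFieldType.

(** Two factors of [g] that are not units vanish at the origin, because [g] is
    homogeneous.  They therefore share a nonzero zero, which is singular on [g] by
    the product rule. *)
Lemma nonsingular_irreducible (g : {mpoly F[3]}) (k : nat) :
    (0 < k)%N -> g \is k.-homog -> lead_coef (poly_in_z g) \is a GRing.unit ->
    (forall v : 'rV[F]_3, v != 0 -> g.@[v 0] = 0 ->
       (forall i, g^`M(i).@[v 0] = 0) -> False) ->
  irreducible g.
Proof.
move=> k0 hg ug smooth.
have g0 : g != 0.
  by apply: contraTneq ug => ->; rewrite /poly_in_z mmap0 lead_coef0 unitr0.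
have nz_unit p q : p * q = g -> p \isn't a GRing.unit -> p.@[fun=> 0] = 0.
  move=> e; apply: contraNeq => pz.
  by apply: (@dhomog_factor_unit _ _ k p q); rewrite ?e.
split=> //.
  apply/negP => ui; have := unit_msize1 ui; case: (msize g) (dhomog_msize hg) => //.
  move=> s hs [s0]; rewrite s0 in hs.
  by move: k0; rewrite (dhomog_uniq g0 hg hs).
move=> p q e; rewrite -[_ || _]negbK negb_or; apply/negP => /andP[np nq].
have p0 := nz_unit p q (esym e) np.
have q0 : q.@[fun=> 0] = 0 by apply: (nz_unit q p); rewrite 1?mulrC.
have up : lead_coef (poly_in_z p) \is a GRing.unit
       /\ lead_coef (poly_in_z q) \is a GRing.unit.
  by apply/andP; rewrite -unitrM -lead_coefM -poly_in_zM -e.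
have [v [v0 pv qv]] := common_zero up.1 up.2 p0 q0.
apply: (smooth v v0); first by rewrite e mevalM pv mul0r.
by move=> i; rewrite e mderivM mevalD !mevalM pv qv mulr0 mul0r addr0.
Qed.

End Irreducible.

(** * Homogeneous coordinates *)

Section Points.
Variable K : fieldType.
Implicit Types (v w : 'rV[K]_3) (P : P2 K) (f g : {mpoly K[3]}).

Lemma P2_coords P : exists2 v, v != 0 & val P = <[v]>%VS.
Proof.
have dP := eqP (valP P).
have v0 : vpick (val P) != 0 by rewrite vpick0 -dimv_eq0 dP.
exists (vpick (val P)) => //; apply/esym/eqP.
by rewrite eqEdim -memvE memv_pick dim_vline v0 dP.
Qed.

Fact point_proof v : \dim (if v == 0%R then <[const_mx 1]> else <[v]>)%VS == 1%N.
Proof.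
case: (eqVneq v 0) => [_|v0]; rewrite dim_vline ?v0 //.
suff -> : (const_mx 1 : 'rV[K]_3) != 0 by [].
by apply/eqP => /rowP/(_ 0)/eqP; rewrite !mxE oner_eq0.
Qed.

(** The zero vector spans no point and is sent to an arbitrary one, which makes
    [point] total. *)
Definition point v : P2 K :=
  exist (fun L : {vspace 'rV[K]_3} => \dim L == 1%N) _ (point_proof v).

Lemma val_point v : v != 0 -> val (point v) = <[v]>%VS.
Proof. by rewrite /point /= => /negPf ->. Qed.

Lemma line_eqP v w : v != 0 -> <[v]>%VS = <[w]>%VS ->
  exists2 c, c != 0 & v = c *: w.
Proof.
move=> v0 e; have /vlineP[c vE] : v \in <[w]>%VS by rewrite -e memv_line.
by exists c => //; apply: contraNneq v0 => c0; rewrite vE c0 scale0r.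
Qed.

Lemma line_scale c v : c != 0 -> <[c *: v]>%VS = <[v]>%VS.
Proof.
move=> c0; apply/eqP; rewrite eqEsubv -!memvE memvZ ?memv_line //=.
by rewrite -{1}(scalerK c0 v) memvZ ?memv_line.
Qed.

Lemma on_curve_coords k f P v : f \is k.-homog -> val P = <[v]>%VS ->
  (on_curve f P <-> f.@[v 0] = 0).
Proof.
move=> hf eP; split=> [|fv w]; first by apply; rewrite eP memv_line.
rewrite eP => /vlineP[c ->].
have -> : f.@[(c *: v) 0] = f.@[fun i => c * v 0 i].
  by apply: meval_eq => i; rewrite mxE.
by rewrite (dhomog_scale _ _ hf) fv mulr0.
Qed.

Lemma singular_coords k f P v : f \is k.+1.-homog -> val P = <[v]>%VS ->
  (singular_at f P <-> f.@[v 0] = 0 /\ forall i, f^`M(i).@[v 0] = 0).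
Proof.
move=> hf eP; rewrite /singular_at (on_curve_coords hf eP).
have h i := on_curve_coords (dhomog_deriv i hf) eP.
by split=> -[fv dv]; split=> // i; apply/h.
Qed.

End Points.

(** * Divisibility, and linear forms as primes *)

Section Divisibility.
Variable K : fieldType.
Implicit Types (f g l p q r : {mpoly K[3]}).

Lemma unit_const p : p \is a GRing.unit -> exists2 c, c != 0 & p = c%:MP.
Proof. by move/unit_msize1/eqP/msize_poly1P. Qed.

Lemma divides_mull p q g : divides g q -> divides g (p * q).
Proof. by case=> r ->; exists (p * r); rewrite mulrA. Qed.

Lemma divides_mulr p q g : divides g p -> divides g (p * q).
Proof. by rewrite mulrC; apply: divides_mull. Qed.

Lemma dividesD p q g : divides g p -> divides g q -> divides g (p + q).
Proof. by move=> [r ->] [s ->]; exists (r + s); rewrite mulrDl. Qed.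

Lemma divides_trans p q r : divides p q -> divides q r -> divides p r.
Proof. by move=> [s ->] [t ->]; exists (t * s); rewrite mulrA. Qed.

Lemma same_curve_divides g h f : same_curve g h -> divides h f -> divides g f.
Proof.
move=> [c c0 ->]; apply: divides_trans; exists c^-1%:MP.
by rewrite mul_mpolyC scalerA mulVf ?scale1r.
Qed.

Lemma same_curve_irreducible g h : same_curve g h -> irreducible h -> irreducible g.
Proof.
move=> [c c0 ->] [h0 nu irr].
have uc : c%:MP \is a @GRing.unit {mpoly K[3]}.
  by apply: (rmorph_unit (@mpolyC 3 K)); rewrite unitfE.
rewrite -mul_mpolyC; split; first by rewrite mulf_neq0 ?mpolyC_eq0.
  by rewrite unitrM negb_and nu orbT.
move=> p q e.
have e2 : h = (c^-1%:MP * p) * q.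
  by rewrite -mulrA -e mulrA -rmorphM /= mulVf // mul1r.
by case/orP: (irr _ _ e2) => [|->]; rewrite ?orbT // unitrM => /andP[_ ->].
Qed.

Lemma irreducible_divides_irreducible g h :
  irreducible g -> irreducible h -> divides g h -> same_curve g h.
Proof.
move=> [_ ng _] [_ _ ih] [q e].
have := ih _ _ e; rewrite (negPf ng) orbF => /unit_const[c c0 qE].
exists c^-1; first by rewrite invr_eq0.
by rewrite e qE mul_mpolyC scalerA mulVf ?scale1r.
Qed.

Section LineForm.
Variables (j k : 'I_3).
Hypothesis jk : j != k.

Let l : {mpoly K[3]} := 'X_j + 'X_k.

Definition restrict p : {mpoly K[3]} :=
  p \mPo [tuple if i == k then - 'X_j else 'X_i | i < 3].

Lemma restrictM : {morph restrict : p q / p * q}.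
Proof. by move=> p q; rewrite /restrict rmorphM. Qed.

Lemma restrictX i : restrict 'X_i = if i == k then - 'X_j else 'X_i.
Proof. by rewrite /restrict comp_mpolyXU -tnth_nth tnth_mktuple. Qed.

Lemma restrict_line : restrict l = 0.
Proof.
by rewrite /restrict comp_mpolyD -!/(restrict _) !restrictX (negPf jk) eqxx subrr.
Qed.

(** The congruence holds for the variables, and it is stable under products and
    linear combinations. *)
Lemma restrict_mod p : divides l (p - restrict p).
Proof.
have mul a b : divides l (a - restrict a) -> divides l (b - restrict b) ->
    divides l (a * b - restrict (a * b)).
  move=> da db; rewrite restrictM.
  have -> : a * b - restrict a * restrict b =
     b * (a - restrict a) + restrict a * (b - restrict b) by ring.
  by apply: dividesD; apply: divides_mull.
have one : divides l (1 - restrict 1).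
  by exists 0; rewrite /restrict comp_mpoly1 subrr mul0r.
elim/mpolyind: p => [|c m p _ _ IH].
  by exists 0; rewrite /restrict comp_mpoly0 subrr mul0r.
rewrite /restrict comp_mpolyD -!/(restrict _) opprD addrACA.
apply: dividesD; last exact: IH.
rewrite /restrict comp_mpolyZ -/(restrict _) -scalerBr -mul_mpolyC.
apply: divides_mull; rewrite mpolyXE_id.
elim/big_ind : _ => [|a b|i _]; [exact: one | exact: mul | ].
elim: (m i) => [|e IHe]; first by rewrite expr0; exact: one.
rewrite exprS; apply: mul IHe; rewrite restrictX.
case: eqP => [->|_]; first by exists 1; rewrite mul1r opprK addrC.
by exists 0; rewrite subrr mul0r.
Qed.

(** [l] divides every polynomial that restricts to 0, and restriction is a ring
    morphism into a domain that kills [l]. *)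
Lemma line_prime p q : divides l (p * q) -> divides l p \/ divides l q.
Proof.
case=> r e.
have vanish a : restrict a = 0 -> divides l a.
  by have := restrict_mod a => /[swap] ->; rewrite subr0.
have /eqP : restrict p * restrict q = 0.
  by rewrite -restrictM e restrictM restrict_line mulr0.
by rewrite mulf_eq0 => /orP[] /eqP /vanish; [left | right].
Qed.

Lemma line_homog : l \is 1.-homog.
Proof. by apply: rpredD; rewrite dhomogX /= mdeg1. Qed.

Lemma line_neq0 : l != 0.
Proof.
apply/eqP => /mpolyP/(_ U_(j)%MM)/eqP.
by rewrite mcoeffD !mcoeffXU mcoeff0 eqxx [k == j]eq_sym (negPf jk) addr0 oner_eq0.
Qed.

Lemma line_irreducible : irreducible l.
Proof.
have sl : msize l = 2%N.
  have := dhomog_uniq line_neq0 line_homog (dhomog_msize line_homog).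
  by rewrite (mpolySpred _ line_neq0) /= => <-.
split; first exact: line_neq0.
  by apply/negP => /unit_msize1; rewrite sl.
move=> p q e; have := line_neq0; rewrite e mulf_eq0 negb_or => /andP[p0 q0].
have := sl; rewrite e msizeM // (mpolySpred _ p0) (mpolySpred _ q0) addnS /=.
case sp : (msize p).-1 => [|a]; case sq : (msize q).-1 => [|b] //.
- by move=> _; rewrite msize1_unit // (mpolySpred _ p0) sp.
- rewrite (@msize1_unit _ _ q) ?orbT //. by rewrite (mpolySpred _ q0) sq.
- by rewrite !addSn addnS.
Qed.

(** The step of unique factorisation that the curve requires: a linear form can be
    split off before testing divisibility by an irreducible polynomial. *)
Lemma irreducible_divides_line_mul g h : irreducible g ->
  divides g (l * h) -> same_curve g l \/ divides g h.
Proof.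
move=> ig [q e].
have /line_prime [[r re]|[r re]] : divides l (q * g).
- by rewrite -e; exists h; rewrite mulrC.
- right; exists r; apply: (mulfI line_neq0).
  by rewrite e re; ring.
left; case: (ig) => _ _ /(_ _ _ re).
case: line_irreducible => _ /negPf -> _; rewrite orbF => /unit_const [c c0 rc].
by exists c => //; rewrite re rc mul_mpolyC.
Qed.

End LineForm.
End Divisibility.

(** * Derivatives and geometric sums *)

Section Derivatives.
Variables (n : nat) (K : fieldType).
Implicit Types (p q : {mpoly K[n]}) (v : 'I_n -> K).

Lemma mderivXU i j : ('X_i : {mpoly K[n]})^`M(j) = (i == j)%:R.
Proof.
rewrite mderivX mnm1E; case: eqP => [->|_]; last by rewrite scale0r.
by rewrite scale1r -[X in (X - _)%MM]addm0 addmC addmK mpolyX0.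
Qed.

Lemma mderiv_exp p k j : (p ^+ k)^`M(j) = (p ^+ k.-1 * p^`M(j)) *+ k.
Proof.
elim: k => [|[|k] IH]; first by rewrite expr0 mulr0n mderivC.
  by rewrite expr1 expr0 mul1r.
by rewrite exprS mderivM IH /= [in RHS]mulrS mulrnAr mulrA -exprS [_^`M(j) * _]mulrC.
Qed.

(** At a zero of [p], the product rule leaves [2 dp dq] in a second derivative of
    [p q].  The gradient of a factor is thus visible on the product. *)
Lemma second_derivs_of_mul (p q : {mpoly K[n]}) i j v :
    p^`M(i) = 1 -> p^`M(j) = 1 -> p.@[v] = 0 ->
  ((p * q)^`M(i)^`M(i)).@[v] - ((p * q)^`M(j)^`M(j)).@[v]
    = (q^`M(i).@[v] - q^`M(j).@[v]) *+ 2.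
Proof.
have twice k : p^`M(k) = 1 -> p.@[v] = 0 ->
    ((p * q)^`M(k)^`M(k)).@[v] = q^`M(k).@[v] *+ 2.
  move=> dp pv; rewrite mderivM dp mul1r mderivD mderivM dp mul1r.
  by rewrite !mevalD mevalM pv mul0r addr0 mulr2n.
by move=> di dj pv; rewrite !twice // mulrnBl.
Qed.

End Derivatives.

Lemma rmorph_geom (A B : comNzRingType) (f : {rmorphism A -> B}) k x y :
  f (\sum_(t < k) x ^+ (k.-1 - t) * y ^+ t) =
  \sum_(t < k) f x ^+ (k.-1 - t) * f y ^+ t.
Proof.
by rewrite rmorph_sum; apply: eq_bigr => t _; rewrite rmorphM !rmorphXn.
Qed.

Lemma geom_diag (A : comNzRingType) k (x : A) :
  \sum_(t < k) x ^+ (k.-1 - t) * x ^+ t = x ^+ k.-1 *+ k.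
Proof.
rewrite (eq_bigr (fun=> x ^+ k.-1)); first by rewrite sumr_const card_ord.
by case: k => [|k] t _; [case: t | rewrite -exprD subnK // -ltnS].
Qed.

(** * The curve and its three lines *)

Local Notation fst_of i := (lift i (0 : 'I_2)).
Local Notation snd_of i := (lift i (1 : 'I_2)).

Section Curve.
Variables (C : numClosedFieldType) (d : nat).
Hypotheses (hd : (3 <= d)%N) (hodd : odd d).
Implicit Types (v w : 'rV[C]_3) (a b c u : C) (i j : 'I_3).
Local Notation f := (curveV C d).

(** Each line is indexed by the coordinate that does not occur in its equation, so
    that one computation covers the three lines and the three families of
    singular points. *)
Definition line i : {mpoly C[3]} := 'X_(fst_of i) + 'X_(snd_of i).

(** Let [S] be the sum of the variables, [j] and [k] the two indices other than
    [i].  As [d] is odd, the equation of the curve is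
    [(X_j^d - (- X_k)^d) - (S^d - X_i^d)], and [S - X_i = X_j + X_k]: both
    differences are multiples of [X_j + X_k].  This is the quotient. *)
Definition line_cofactor i : {mpoly C[3]} :=
  \sum_(t < d) 'X_(fst_of i) ^+ (d.-1 - t) * (- 'X_(snd_of i)) ^+ t
  - \sum_(t < d) (\sum_j 'X_j) ^+ (d.-1 - t) * 'X_i ^+ t.

Lemma curveVE : f = \sum_i 'X_i ^+ d - (\sum_i 'X_i) ^+ d.
Proof.
rewrite !big_ord_recl !big_ord0 !addr0 !addrA /curveV /varx /vary /varz.
by congr (_ + 'X__ ^+ _ + 'X__ ^+ _ - (_ + 'X__ + 'X__) ^+ _); apply: val_inj.
Qed.

Lemma sum_around (A : nmodType) (F : 'I_3 -> A) i :
  \sum_j F j = F i + (F (fst_of i) + F (snd_of i)).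
Proof.
rewrite (bigD1_ord i) //= !big_ord_recl big_ord0 addr0.
by congr (_ + (_ + F (lift _ _))); apply: val_inj.
Qed.

Lemma curve_factor i : f = line i * line_cofactor i.
Proof.
rewrite curveVE /line_cofactor mulrBr {1}(sum_around _ i).
have -> : line i = 'X_(fst_of i) - - 'X_(snd_of i) by rewrite opprK.
rewrite -subrXX opprK.
have -> : 'X_(fst_of i) + 'X_(snd_of i) = \sum_j 'X_j - 'X_i :> {mpoly C[3]}.
  by rewrite (sum_around _ i); ring.
rewrite -subrXX exprNn -signr_odd hodd expr1 mulN1r opprK; ring.
Qed.

Lemma curve_homog : f \is d.-homog.
Proof.
have hX i : ('X_i : {mpoly C[3]}) \is 1.-homog by rewrite dhomogX /= mdeg1.
rewrite curveVE -[d in d.-homog]mul1n; apply: rpredB; last first.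
  by apply: dhomogMn; apply: rpred_sum.
by apply: rpred_sum => i _; apply: dhomogMn.
Qed.

Lemma mderiv_sum_vars i : (\sum_j 'X_j : {mpoly C[3]})^`M(i) = 1.
Proof.
rewrite raddf_sum (bigD1 i) //= mderivXU eqxx big1 ?addr0 // => j ji.
by rewrite mderivXU (negPf ji).
Qed.

Lemma curve_deriv i : f^`M(i) = ('X_i ^+ d.-1 - (\sum_j 'X_j) ^+ d.-1) *+ d.
Proof.
rewrite curveVE mderivB mderiv_exp mderiv_sum_vars mulr1 mulrnBl.
congr (_ - _); rewrite raddf_sum (bigD1 i) //= mderiv_exp mderivXU eqxx mulr1.
by rewrite big1 ?addr0 // => j ji; rewrite mderiv_exp mderivXU (negPf ji) mulr0 mul0rn.
Qed.

Lemma curve_deriv2 i :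
  f^`M(i)^`M(i) = ('X_i ^+ d.-2 - (\sum_j 'X_j) ^+ d.-2) *+ (d.-1 * d).
Proof.
rewrite curve_deriv raddfMn /= mderivB !mderiv_exp mderiv_sum_vars.
by rewrite mderivXU eqxx !mulr1 -mulrnBl mulrnA.
Qed.

(** [(a, b)] is a homogeneous parameter on line [i], chosen so that the sum of the
    coordinates is [a]. *)
Definition pt i a b : 'rV[C]_3 :=
  \row_j (if unlift i j is Some k then if k == 0 then b else - b else a).

Lemma pt_at i a b : pt i a b 0 i = a.
Proof. by rewrite mxE unlift_none. Qed.

Lemma pt_fst i a b : pt i a b 0 (fst_of i) = b.
Proof. by rewrite mxE liftK. Qed.

Lemma pt_snd i a b : pt i a b 0 (snd_of i) = - b.
Proof. by rewrite mxE liftK. Qed.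

Definition ptE := (pt_at, pt_fst, pt_snd).

Lemma row_aroundP i v w : v 0 i = w 0 i -> v 0 (fst_of i) = w 0 (fst_of i) ->
  v 0 (snd_of i) = w 0 (snd_of i) -> v = w.
Proof.
move=> e0 e1 e2; apply/rowP => j; case: (unliftP i j) => [k|] -> //.
by case: k => [[|[|k]] Hk] //; [move: e1 | move: e2];
  congr (v 0 (lift _ _) = w 0 (lift _ _)); apply: val_inj.
Qed.

Lemma pt_scale i a b c : c *: pt i a b = pt i (c * a) (c * b).
Proof.
have h j : (c *: pt i a b) 0 j = c * pt i a b 0 j by rewrite mxE.
by apply: (@row_aroundP i); rewrite h !ptE ?mulrN.
Qed.

Lemma line_eval i v : (line i).@[v 0] = v 0 (fst_of i) + v 0 (snd_of i).
Proof. by rewrite mevalD !mevalXU. Qed.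

Lemma on_line_pt i v : (line i).@[v 0] = 0 -> v = pt i (v 0 i) (v 0 (fst_of i)).
Proof.
rewrite line_eval => /eqP; rewrite addr_eq0 => /eqP e.
by apply: (@row_aroundP i); rewrite !ptE // e opprK.
Qed.

Lemma line_pt i a b : (line i).@[pt i a b 0] = 0.
Proof. by rewrite line_eval !ptE subrr. Qed.

Lemma sum_pt i a b : \sum_j pt i a b 0 j = a.
Proof. by rewrite (sum_around _ i) !ptE subrr addr0. Qed.

Lemma eval_sum v : (\sum_j 'X_j : {mpoly C[3]}).@[v 0] = \sum_j v 0 j.
Proof. by rewrite raddf_sum; apply: eq_bigr => j _; rewrite /= mevalXU. Qed.

Lemma cofactor_pt i a b : (line_cofactor i).@[pt i a b 0] = (b ^+ d.-1 - a ^+ d.-1) *+ d.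
Proof.
rewrite mevalB !rmorph_geom /= mevalN !mevalXU !ptE eval_sum sum_pt opprK.
by rewrite !geom_diag mulrnBl.
Qed.

Lemma pt_neq0 i u : pt i 1 u != 0.
Proof.
by apply/eqP => /rowP/(_ i)/eqP; rewrite ptE mxE oner_eq0.
Qed.

Lemma unity_neq0 u : u ^+ d.-1 = 1 -> u != 0.
Proof.
move=> e; apply: contraTneq (oner_neq0 C) => u0; rewrite -e u0 expr0n.
by case: (d) hd => [|[|n]] //=; rewrite eqxx.
Qed.

(** At [pt i 1 u] the two pure second derivatives of the curve differ by
    [2 d (d-1) u^(d-2)], since [d - 2] is odd.  Hence the gradient of the cofactor
    is not proportional to that of the line, whose two components are 1. *)
Lemma cofactor_tangent i u : u ^+ d.-1 = 1 ->
  (line_cofactor i)^`M(fst_of i).@[pt i 1 u 0] !=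
  (line_cofactor i)^`M(snd_of i).@[pt i 1 u 0].
Proof.
move=> ue.
have dl j : j \in [:: fst_of i; snd_of i] -> (line i)^`M(j) = 1.
  rewrite /line mderivD !mderivXU !inE => /orP[] /eqP ->; rewrite eqxx.
    by rewrite (inj_eq lift_inj) addr0.
  by rewrite (inj_eq lift_inj) add0r.
have in1 : fst_of i \in [:: fst_of i; snd_of i] by rewrite mem_head.
have in2 : snd_of i \in [:: fst_of i; snd_of i] by rewrite !inE eqxx orbT.
have := second_derivs_of_mul (line_cofactor i) (dl _ in1) (dl _ in2) (line_pt i 1 u).
rewrite -curve_factor !curve_deriv2 !mevalMn !mevalB !rmorphXn /= !mevalXU.
rewrite eval_sum sum_pt !ptE => h; apply/eqP => AB.
move: h; rewrite AB subrr mul0rn -mulrnBl.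
have -> : (- u) ^+ d.-2 = - u ^+ d.-2.
  have od2 : odd d.-2 by rewrite -subn2 oddB ?hodd // ltnW.
  by rewrite exprNn -signr_odd od2 expr1 mulN1r.
have -> : u ^+ d.-2 - 1 ^+ d.-2 - (- u ^+ d.-2 - 1 ^+ d.-2) = u ^+ d.-2 *+ 2 by ring.
move/eqP; rewrite -mulrnA mulrn_eq0 expf_eq0 (negPf (unity_neq0 ue)) andbF orbF.
by rewrite !muln_eq0; case: (d) hd => [|[|[|n]]].
Qed.

End Curve.

(** * Transverse crossings *)

Section Nodes.
Variable C : numClosedFieldType.

Lemma mpoly_ps_mul n (p q : {mpoly C[n]}) m :
  ps_mul (fun k => p@_k) (fun k => q@_k) m = (p * q)@_m.
Proof. by apply/esym/mcoeff_poly_mul_lin. Qed.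

Lemma mpoly_ps_convergent n (p : {mpoly C[n]}) : ps_convergent (fun m => p@_m).
Proof.
(* As [M] is at least 1 and bounds all coefficients, so do its powers. *)
pose M := 1 + \sum_(m <- msupp p) `|p@_m|.
have M1 : 1 <= M by rewrite lerDl sumr_ge0.
exists M => m; apply: (@le_trans _ _ M); last first.
  by rewrite -[X in X <= _]expr1; apply: ler_weXn2l.
have [mp|/memN_msupp_eq0 ->] := boolP (m \in msupp p); last first.
  by rewrite normr0 (le_trans ler01).
rewrite /M (bigD1_seq m) ?msupp_uniq //= addrCA lerDl.
by rewrite addr_ge0 ?ler01 // sumr_ge0.
Qed.

(** [l g = ((l + g)/2)^2 + ((l - g)/(2i))^2], and the two squared polynomials are
    local coordinates when [l] and [g] have independent linear parts. *)
Lemma A1_germ_crossing (l g : {mpoly C[2]}) : l@_0 = 0 -> g@_0 = 0 ->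
  l@_U_(0) * g@_U_(1) - l@_U_(1) * g@_U_(0) != 0 -> A1_germ (l * g).
Proof.
move=> l0 g0 jac.
have i2 : ('i : C) ^+ 2 = -1 by exact: sqrCi.
have n2 : (2 : C) != 0 by rewrite pnatr_eq0.
pose a := 2^-1 *: (l + g); pose b := (2 * 'i)^-1 *: (l - g).
have i0 : ('i : C) != 0 by rewrite neq0Ci.
have sq : a ^+ 2 + b ^+ 2 = l * g.
  rewrite /a /b -!mul_mpolyC !exprMn -!rmorphXn /= !exprVn exprMn i2.
  have -> : (2 ^+ 2 * -1)^-1 = - (2 ^+ 2)^-1 :> C by rewrite mulrN1 invrN.
  rewrite rmorphN /= mulNr -mulrBr.
  have -> : (l + g) ^+ 2 - (l - g) ^+ 2 = (2 ^+ 2)%:MP * (l * g).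
    by rewrite (_ : 2 ^+ 2 = 4%:R) ?mpolyC_nat; ring.
  by rewrite [LHS]mulrA -mpolyCM mulVf ?mul1r // expf_neq0.
exists (fun m => a@_m), (fun m => b@_m), (fun m => (1 : {mpoly C[2]})@_m).
split; [split| | |].
- exact: mpoly_ps_convergent.
- exact: mpoly_ps_convergent.
- by rewrite mcoeffZ mcoeffD l0 g0 addr0 mulr0.
- by rewrite mcoeffZ mcoeffB l0 g0 subrr mulr0.
- rewrite !mcoeffZ !mcoeffD !mcoeffN.
  set l0' := l@_U_(0) in jac *; set l1' := l@_U_(1) in jac *.
  set g0' := g@_U_(0) in jac *; set g1' := g@_U_(1) in jac *.
  have -> : 2^-1 * (l0' + g0') * ((2 * 'i)^-1 * (l1' - g1')) -
     2^-1 * (l1' + g1') * ((2 * 'i)^-1 * (l0' - g0')) =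
     - 'i^-1 / 2 * (l0' * g1' - l1' * g0') by field; rewrite ?n2 ?i0.
  by rewrite !mulf_neq0 ?oppr_eq0 ?invr_eq0.
- exact: mpoly_ps_convergent.
- by rewrite mcoeff1 eqxx oner_neq0.
move=> m; rewrite -sq -[LHS]/((a ^+ 2 + b ^+ 2)@_m) -[a ^+ 2 + b ^+ 2]mul1r -mpoly_ps_mul.
apply: eq_bigr => k _; congr (_ * _).
by rewrite mcoeffD /ps_add !mpoly_ps_mul !expr2.
Qed.

Section Chart.
Variables (i : 'I_3) (v : 'rV[C]_3).
Hypothesis vi : v 0 i != 0.
Implicit Types p q : {mpoly C[3]}.

Lemma local_eqM : {morph local_eq i v : p q / p * q}.
Proof. by move=> p q; rewrite /local_eq rmorphM. Qed.

Lemma local_eq_origin p : (local_eq i v p)@_0 = p.@[fun j => v 0 j / v 0 i].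
Proof.
rewrite -meval_zero comp_mpoly_meval; apply: meval_eq => j.
rewrite tnth_mktuple; case: unliftP => [k|] ->; last by rewrite meval1 divff.
by rewrite mevalD mevalXU mevalC add0r.
Qed.

(** The chart is an affine embedding of the plane in which coordinate [i] is fixed
    and the others move with slope 1, so this is the chain rule.  Both sides are
    derivations, which reduces it to the variables. *)
Lemma local_eq_deriv p k : (local_eq i v p)^`M(k) = local_eq i v p^`M(lift i k).
Proof.
pose D p := (local_eq i v p)^`M(k) = local_eq i v p^`M(lift i k).
have mul p1 p2 : D p1 -> D p2 -> D (p1 * p2).
  rewrite /D local_eqM !mderivM => -> ->.
  by rewrite /local_eq comp_mpolyD -!/(local_eq _ _ _) !local_eqM.
have one : D 1 by rewrite /D /local_eq comp_mpoly1 !mderivC comp_mpoly0.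
elim/mpolyind: p => [|c m p _ _ IH].
  by rewrite /local_eq comp_mpoly0 !mderiv0 comp_mpoly0.
rewrite /local_eq !comp_mpolyD !mderivD comp_mpolyD -!/(local_eq _ _ _) IH.
congr (_ + _); rewrite /local_eq comp_mpolyZ !mderivZ comp_mpolyZ; congr (_ *: _).
rewrite -!/(local_eq _ _ _) -/(D _) mpolyXE_id.
elim/big_ind : _ => // j _; elim: (m j) => [|e IHe]; first by rewrite expr0.
rewrite exprS; apply: mul IHe.
rewrite /D /local_eq comp_mpolyXU -tnth_nth tnth_mktuple mderivXU.
case: unliftP => [k'|] ->.
  rewrite mderivD mderivC addr0 mderivXU (inj_eq lift_inj).
  by case: eqP; rewrite ?comp_mpoly1 ?comp_mpoly0.
by rewrite mderivC (negPf (neq_lift _ _)) comp_mpoly0.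
Qed.

Lemma local_eq_linear p k :
  (local_eq i v p)@_U_(k) = p^`M(lift i k).@[fun j => v 0 j / v 0 i].
Proof.
by rewrite -local_eq_origin -local_eq_deriv mcoeff_deriv add0m mnm0E mulr1n.
Qed.

End Chart.
End Nodes.

(** * The singular points *)

Section Singularities.
Variables (C : numClosedFieldType) (d : nat).
Hypotheses (hd : (3 <= d)%N) (hodd : odd d).
Implicit Types (v w : 'rV[C]_3) (a b c u : C) (i j : 'I_3).
Local Notation f := (curveV C d).

Lemma d_neq0 : (d%:R : C) != 0.
Proof. by rewrite pnatr_eq0; case: (d) hd. Qed.

Lemma d1_gt0 : (0 < d.-1)%N. Proof. by case: (d) hd => [|[|n]]. Qed.

Lemma even_pow (A : comNzRingType) (x : A) : (- x) ^+ d.-1 = x ^+ d.-1.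
Proof.
have e : odd d.-1 = false by rewrite -subn1 oddB ?hodd // (leq_trans _ hd).
by rewrite exprNn -signr_odd e expr0 mul1r.
Qed.

(** The hypotheses give [x], [y], [z] and [s] the same modulus, so that conjugation
    acts on them as [t |-> N / t] with [N = s s^*], unless they are all 0.  The
    conjugate of [s = x + y + z], cleared of denominators, is
    [xyz = s (xy + xz + yz)], and [(x + y)(x + z)(y + z)] is the difference of the
    two sides. *)
Lemma equal_powers_sum (x y z : C) k : (0 < k)%N ->
    x ^+ k = (x + y + z) ^+ k -> y ^+ k = (x + y + z) ^+ k ->
    z ^+ k = (x + y + z) ^+ k ->
  (x + y) * (x + z) * (y + z) = 0.
Proof.
set s := x + y + z => k0 ex ey ez.
have norm_eq t : t ^+ k = s ^+ k -> `|t| = `|s|.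
  move=> e; apply/eqP; rewrite -(@eqrXn2 _ k) ?normr_ge0 //.
  by rewrite -!normrX e.
have conj_eq t : t ^+ k = s ^+ k -> t * t^* = s * s^*.
  by move/norm_eq => e; rewrite -!normCK e.
have cx := conj_eq _ ex; have cy := conj_eq _ ey; have cz := conj_eq _ ez.
have [s0|s0] := eqVneq s 0.
  have -> : x = 0 by apply/eqP; rewrite -normr_eq0 (norm_eq _ ex) s0 normr0.
  have -> : y = 0 by apply/eqP; rewrite -normr_eq0 (norm_eq _ ey) s0 normr0.
  by rewrite addr0 !mul0r.
have N0 : s * s^* != 0 by rewrite mulf_neq0 ?conjC_eq0.
apply: (mulfI N0); rewrite mulr0.
have cs : s^* = x^* + y^* + z^* by rewrite !rmorphD.
have e : s * s^* * (x * y * z) = s * (s * s^*) * (x * y + x * z + y * z).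
  transitivity (s * ((x * x^*) * (y * z) + (y * y^*) * (x * z) + (z * z^*) * (x * y))).
    by rewrite cs; ring.
  by rewrite cx cy cz; ring.
have -> : s * s^* * ((x + y) * (x + z) * (y + z)) =
   s * (s * s^*) * (x * y + x * z + y * z) - s * s^* * (x * y * z).
  by rewrite /s; ring.
by rewrite e subrr.
Qed.

Lemma line_as_sum i v : (line C i).@[v 0] = \sum_j v 0 j - v 0 i.
Proof. by rewrite line_eval (sum_around _ i); ring. Qed.

Lemma sum3 v : \sum_j v 0 j = v 0 0 + v 0 1 + v 0 2.
Proof.
rewrite !big_ord_recl big_ord0 addr0 addrA.
by congr (_ + v _ _ + v _ _); apply: val_inj.
Qed.

Lemma curve_deriv_eval i v :
  f^`M(i).@[v 0] = (v 0 i ^+ d.-1 - (\sum_j v 0 j) ^+ d.-1) *+ d.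
Proof. by rewrite curve_deriv mevalMn mevalB !rmorphXn /= mevalXU eval_sum. Qed.

Lemma singular_vector v : v != 0 -> (forall i, f^`M(i).@[v 0] = 0) ->
  exists i u c, [/\ u ^+ d.-1 = 1, c != 0 & v = c *: pt i 1 u].
Proof.
move=> v0 dv; set s := \sum_j v 0 j.
have pw i : v 0 i ^+ d.-1 = s ^+ d.-1.
  have /eqP := dv i; rewrite curve_deriv_eval mulrn_eq0 subr_eq0.
  by case: (d) hd => // n _ /eqP.
have [i li] : exists i, (line C i).@[v 0] = 0.
  have := @equal_powers_sum (v 0 0) (v 0 1) (v 0 2) d.-1 d1_gt0.
  rewrite -!sum3 -/s !pw => /(_ erefl erefl erefl) /eqP.
  by rewrite !mulf_eq0 => /orP[/orP[]|] /eqP e;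
   [exists 2 | exists 1 | exists 0]; rewrite line_as_sum sum3; rewrite -[RHS]e; ring.
have vE := on_line_pt li; set a := v 0 i in vE; set b := v 0 (fst_of i) in vE.
have sa : s = a by rewrite /s vE sum_pt.
have a0 : a != 0.
  apply: contraNneq v0 => a0; apply/eqP/rowP => j; rewrite mxE; apply/eqP.
  have /eqP := pw j; rewrite sa a0 expr0n eqn0Ngt d1_gt0.
  by rewrite expf_eq0 => /andP[].
exists i, (b / a), a; split=> //.
  by rewrite expr_div_n /a /b !pw divff // expf_neq0 // sa.
by rewrite pt_scale mulr1 mulrCA divff ?mulr1.
Qed.

Lemma singular_atP P : singular_at f P <->
  exists i u, u ^+ d.-1 = 1 /\ val P = vline (pt i 1 u).
Proof.
have hf : f \is d.-1.+1.-homog by rewrite prednK ?(leq_trans _ hd) // curve_homog.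
split=> [sP | [i [u [ue eP]]]].
  have [v v0 eP] := P2_coords P.
  have [_ dv] := (singular_coords hf eP).1 sP.
  have [i [u [c [ue c0 vE]]]] := singular_vector v0 dv.
  by exists i, u; rewrite eP vE line_scale.
apply/(singular_coords hf eP); split=> [|j].
  by rewrite (curve_factor _ hodd i) mevalM line_pt mul0r.
rewrite curve_deriv_eval sum_pt expr1n.
suff -> : pt i 1 u 0 j ^+ d.-1 = 1 by rewrite subrr mul0rn.
case: (unliftP i j) => [k|] ->; last by rewrite pt_at expr1n.
by rewrite mxE liftK; case: eqP; rewrite ?even_pow.
Qed.

Lemma singular_A1 P : singular_at f P -> type_A1_at f P.
Proof.
case/singular_atP => i [u [ue eP]]; exists i, (pt i 1 u).
rewrite eP memv_line pt_at oner_neq0; split=> //.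
have v0 : pt i 1 u 0 i != 0 by rewrite pt_at oner_neq0.
rewrite (curve_factor _ hodd i) local_eqM.
have nrm (p : {mpoly C[3]}) : p.@[fun j => pt i 1 u 0 j / pt i 1 u 0 i] = p.@[pt i 1 u 0].
  by apply: meval_eq => j; rewrite pt_at divr1.
apply: A1_germ_crossing.
- by rewrite local_eq_origin // nrm line_pt.
- by rewrite local_eq_origin // nrm cofactor_pt ue expr1n subrr mul0rn.
rewrite !local_eq_linear // !nrm.
have -> : (line C i)^`M(fst_of i) = 1.
  by rewrite /line mderivD !mderivXU eqxx (inj_eq lift_inj) addr0.
have -> : (line C i)^`M(snd_of i) = 1.
  by rewrite /line mderivD !mderivXU eqxx (inj_eq lift_inj) add0r.
rewrite meval1 !mul1r subr_eq0 eq_sym; exact: cofactor_tangent.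
Qed.

Lemma pt_vec3 u :
  [/\ pt 0 1 u = vec3 1 u (- u), pt 1 1 u = vec3 u 1 (- u) & pt 2 1 u = vec3 u (- u) 1].
Proof.
split.
- by apply: (@row_aroundP _ 0); rewrite !ptE !mxE.
- by apply: (@row_aroundP _ 1); rewrite !ptE !mxE.
- by apply: (@row_aroundP _ 2); rewrite !ptE !mxE.
Qed.

Lemma ord3P i : [\/ i = 0, i = 1 | i = 2].
Proof.
by case: i => [[|[|[|i]]] Hi] //; [constructor 1|constructor 2|constructor 3];
  apply: val_inj.
Qed.

Lemma unity_roots : exists rs : seq C,
  [/\ uniq rs, size rs = d.-1 & forall u, (u \in rs) = (u ^+ d.-1 == 1)].
Proof.
have [rs e] := closed_field_poly_normal ('X^(d.-1) - 1 : {poly C}).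
rewrite (monicP (monic_Xn_sub_1 _ d1_gt0)) scale1r in e.
exists rs; split.
- rewrite -separable_prod_XsubC -e separable_Xn_sub_1 // pnatr_eq0 -lt0n.
  exact: d1_gt0.
- have := size_Xn_sub_1 C d1_gt0; rewrite e size_prod_XsubC => -[]; exact.
- by move=> u; rewrite -root_prod_XsubC -e rootE !hornerE subr_eq0.
Qed.

Lemma has_exactly_points (T : eqType) (s : seq T) (F : T -> 'rV[C]_3)
    (A : P2 C -> Prop) n :
    uniq s -> size s = n -> (forall x, F x != 0) ->
    (forall x y, x \in s -> y \in s -> vline (F x) = vline (F y) -> x = y) ->
    (forall P, A P <-> exists2 x, x \in s & val P = vline (F x)) ->
  has_exactly n A.
Proof.
move=> us ss F0 inj hA; exists [seq point (F x) | x <- s]; split.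
- rewrite map_inj_in_uniq // => x y xs ys /(congr1 val).
  by rewrite !val_point //; apply: inj.
- by rewrite size_map.
move=> P; rewrite hA; split.
  by case/mapP => x xs ->; exists x => //; rewrite val_point.
case=> x xs eP; apply/mapP; exists x => //.
by apply: val_inj; rewrite eP val_point.
Qed.

Lemma pt_line_inj i u (w : C) : vline (pt i 1 u) = vline (pt i 1 w) -> u = w.
Proof.
move/(line_eqP (pt_neq0 i u)) => [c _]; rewrite pt_scale mulr1 => e.
have c1 : c = 1 by have := congr1 (fun v : 'rV_3 => v 0 i) e; rewrite !pt_at.
have := congr1 (fun v : 'rV_3 => v 0 (fst_of i)) e.
by rewrite !pt_fst c1 mul1r.
Qed.

Lemma vec3_eq a b c x y z : vec3 a b c = vec3 x y z <-> [/\ a = x, b = y & c = z].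
Proof.
split=> [/rowP e|[-> -> ->] //].
by have := e 0; have := e 1; have := e 2; rewrite !mxE.
Qed.

Lemma vec3_scale k a b c : k *: vec3 a b c = vec3 (k * a) (k * b) (k * c).
Proof. by apply/rowP => -[[|[|[|j]]] Hj] //; rewrite !mxE. Qed.

Lemma pt_line01 u (w : C) : vline (pt 0 1 u) = vline (pt 1 1 w) -> w = 1.
Proof.
move/(line_eqP (pt_neq0 0 u)) => [c c0].
have [-> _ _] := pt_vec3 u; have [_ -> _] := pt_vec3 w.
rewrite vec3_scale => /vec3_eq[e1 e2 e3].
have u1 : u = 1 by rewrite e1 -[u]opprK e3 mulrN opprK.
by rewrite u1 mulr1 in e2; rewrite -e2 mul1r in e1.
Qed.

Lemma pt_line02 u (w : C) : vline (pt 0 1 u) = vline (pt 2 1 w) -> w = 1.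
Proof.
move/(line_eqP (pt_neq0 0 u)) => [c c0].
have [-> _ _] := pt_vec3 u; have [_ _ ->] := pt_vec3 w.
rewrite vec3_scale mulr1 => /vec3_eq[e1 e2 e3].
have c1 : c = 1 by rewrite -e3 e2 mulrN opprK -e1.
by rewrite c1 mul1r in e1.
Qed.

Lemma pt_line12 u (w : C) : vline (pt 1 1 u) = vline (pt 2 1 w) -> w = -1.
Proof.
move/(line_eqP (pt_neq0 1 u)) => [c c0].
have [_ -> _] := pt_vec3 u; have [_ _ ->] := pt_vec3 w.
rewrite vec3_scale mulr1 => /vec3_eq[e1 e2 e3].
have u1 : u = -1 by rewrite e2 mulrN opprK.
by move: e1; rewrite -e3 u1 opprK mul1r.
Qed.

Lemma pt_coincide :
  [/\ pt 1 1 1 = pt 0 1 1 :> 'rV[C]_3, pt 2 1 1 = pt 0 1 (-1) :> 'rV[C]_3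
    & pt 2 1 (-1) = pt 1 1 (-1) :> 'rV[C]_3].
Proof.
have [p0 p1 p2] := pt_vec3 1; have [m0 m1 m2] := pt_vec3 (-1).
by rewrite p0 p1 p2 m0 m1 m2 opprK.
Qed.

(** Two of the three families share exactly one point, a vertex of the triangle.
    The parameters 1 and -1 are dropped where they give a vertex already listed. *)
Definition sing_list (rs : seq C) : seq ('I_3 * C) :=
  [seq (0, u) | u <- rs] ++ [seq (1, u) | u <- rs & u != 1]
  ++ [seq (2, u) | u <- rs & (u != 1) && (u != -1)].

Lemma size_filter_neq (T : eqType) (x : T) (s : seq T) : uniq s -> x \in s ->
  size [seq y <- s | y != x] = (size s).-1.
Proof. by move=> us xs; rewrite -(rem_filter x us) size_rem. Qed.

Lemma size_filter_neq2 (T : eqType) (x y : T) (s : seq T) : uniq s ->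
  x \in s -> y \in s -> x != y ->
  size [seq z <- s | (z != x) && (z != y)] = (size s).-2.
Proof.
move=> us xs ys xy; rewrite filter_predI size_filter_neq ?filter_uniq //.
  by rewrite size_filter_neq.
by rewrite mem_filter xs xy.
Qed.

Lemma one_neq_m1 : (1 : C) != -1.
Proof. by rewrite -subr_eq0 opprK -mulr2n mulrn_eq0 oner_eq0. Qed.

Lemma singular_count : has_exactly (3 * (d - 2))%N (singular_at f).
Proof.
have [rs [urs srs rsE]] := unity_roots.
have r1 : 1 \in rs by rewrite rsE expr1n.
have rm1 : -1 \in rs by rewrite rsE even_pow expr1n.
apply: (@has_exactly_points _ (sing_list rs) (fun x => pt x.1 1 x.2)).
- rewrite !cat_uniq !map_inj_uniq ?filter_uniq //; try by move=> ? ? [].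
  rewrite has_cat !negb_or /=; apply/and3P; split=> //.
    apply/andP; split; apply/hasPn => x /mapP[u _ ->] /=; apply/negP.
      by case/mapP.
    by case/mapP.
  by rewrite andbT; apply/hasPn => x /mapP[u _ ->] /=; apply/negP => /mapP[].
- rewrite /sing_list !size_cat !size_map size_filter_neq //.
  rewrite size_filter_neq2 ?one_neq_m1 // srs.
  by case: (d) hd => [|[|[|n]]] //= _; lia.
- by move=> x; apply: pt_neq0.
- have in1 i u : (i, u) \in sing_list rs -> i = 1 -> u != 1.
    move=> h i1; move: h; rewrite i1 !mem_cat => /or3P[] /mapP[x] //.
    by rewrite mem_filter => /andP[x1 _] [->].
  have in2 i u : (i, u) \in sing_list rs -> i = 2 -> (u != 1) && (u != -1).
    move=> h i2; move: h; rewrite i2 !mem_cat => /or3P[] /mapP[x] //.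
    by rewrite mem_filter => /andP[x1 _] [->].
  move=> [i u] [j w] /= /[dup] /in1 i1 /in2 i2 /[dup] /in1 j1 /in2 j2 e.
  case: (ord3P i) e i1 i2 j1 j2 => ->; case: (ord3P j) => -> e i1 i2 j1 j2.
  + by rewrite (pt_line_inj e).
  + by have := j1 erefl; rewrite (pt_line01 e) eqxx.
  + by have := j2 erefl; rewrite (pt_line02 e) eqxx.
  + by have := i1 erefl; rewrite (pt_line01 (esym e)) eqxx.
  + by rewrite (pt_line_inj e).
  + by have := j2 erefl; rewrite (pt_line12 e) eqxx andbF.
  + by have := i2 erefl; rewrite (pt_line02 (esym e)) eqxx.
  + by have := i2 erefl; rewrite (pt_line12 (esym e)) eqxx andbF.
  + by rewrite (pt_line_inj e).
move=> P; rewrite singular_atP; split.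
  move=> [i [u [/eqP ue eP]]]; rewrite -rsE in ue.
  have [c1 c2 c3] := pt_coincide.
  have in0 x : x \in rs -> (0, x) \in sing_list rs.
    by move=> xs; rewrite mem_cat map_f.
  have in1 x : x \in rs -> x != 1 -> (1, x) \in sing_list rs.
    by move=> xs x1; rewrite !mem_cat (map_f (pair 1)) ?orbT // mem_filter x1.
  have [i0|i1|i2] := ord3P i; rewrite ?i0 ?i1 ?i2 in eP.
  + by exists (0, u); rewrite ?in0.
  + have [u1|u1] := eqVneq u 1; last by exists (1, u); rewrite ?in1.
    by exists (0, 1); rewrite ?in0 // eP u1 c1.
  have [u1|u1] := eqVneq u 1; first by exists (0, -1); rewrite ?in0 // eP u1 c2.
  have [um1|um1] := eqVneq u (-1).
    by exists (1, -1); rewrite ?in1 // 1?eq_sym ?one_neq_m1 // eP um1 c3.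
  exists (2, u) => //; rewrite !mem_cat (map_f (pair 2)) ?orbT //.
  by rewrite mem_filter u1 um1.
case=> -[i u] /= us eP; exists i, u; split=> //; apply/eqP; rewrite -rsE.
move: us; rewrite !mem_cat => /or3P[] /mapP[w]; rewrite ?mem_filter.
- by move=> ws [_ ->].
- by move=> /andP[_ ws] [_ ->].
- by move=> /andP[_ ws] [_ ->].
Qed.

End Singularities.

(** * Reducedness and the residual curve *)

(** Each of the [n] terms of the sum is monic of degree [n - 1]. *)
Lemma lead_coef_geom_shift (A : idomainType) n (c s : A) :
    (1 < n)%N -> n%:R != 0 :> A ->
  lead_coef (c%:P - \sum_(t < n) ('X + s%:P) ^+ (n.-1 - t) * 'X ^+ t) = - n%:R.
Proof.
move=> n1 n0; set p := _ - _.
have termE (t : 'I_n) : size (('X + s%:P) ^+ (n.-1 - t) * 'X ^+ t) = n /\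
   (('X + s%:P) ^+ (n.-1 - t) * 'X ^+ t)`_n.-1 = 1.
  have -> : 'X + s%:P = 'X - (- s)%:P by rewrite polyCN opprK.
  have sz : size (('X - (- s)%:P) ^+ (n.-1 - t) * 'X ^+ t) = n.
    rewrite size_mulXn ?monic_neq0 ?monic_exp ?monicXsubC // size_exp_XsubC.
    by have := ltn_ord t; lia.
  split=> //.
  have /monicP : ('X - (- s)%:P) ^+ (n.-1 - t) * 'X ^+ t \is monic.
    by rewrite monicMr ?monicXn // monic_exp // monicXsubC.
  by rewrite lead_coefE sz.
have pc : p`_n.-1 = - n%:R.
  rewrite coefB coefC coef_sum; under eq_bigr do rewrite (termE _).2.
  rewrite sumr_const card_ord; case: (n) n1 => [|[|m]] //= _; exact: sub0r.
have sp : size p = n.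
  apply/eqP; rewrite eqn_leq; apply/andP; split.
    apply: leq_trans (size_polyD _ _) _; rewrite geq_max size_polyN; apply/andP; split.
      by rewrite (leq_trans (size_polyC_leq1 _)) // ltnW.
    by apply: leq_trans (size_sum _ _ _) _; apply/bigmax_leqP => t _; rewrite (termE t).1.
  rewrite leqNgt; apply/negP => h; move: n0.
  by rewrite -oppr_eq0 -pc nth_default ?eqxx // -ltnS prednK // ltnW.
by rewrite lead_coefE sp pc.
Qed.

Section Reduced.
Variables (C : numClosedFieldType) (d : nat).
Hypotheses (hd : (3 <= d)%N) (hodd : odd d).
Implicit Types (v w : 'rV[C]_3) (a b c u : C) (i j : 'I_3) (P : P2 C).
Local Notation f := (curveV C d).

Lemma curve_neq0 : f != 0.
Proof.
rewrite (curve_factor _ hodd 0) mulf_neq0 ?line_neq0 ?(inj_eq lift_inj) //.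
apply: contra_neq (d_neq0 C hd) => h; have := cofactor_pt d 0 (0 : C) 1.
by rewrite h meval0 expr1n expr0n eqn0Ngt (d1_gt0 hd) subr0.
Qed.

Lemma coef_powers_diff k i j m : ('X_i ^+ k - 'X_j ^+ k : {mpoly C[3]})@_m =
  ((U_(i) *+ k)%MM == m)%:R - ((U_(j) *+ k)%MM == m)%:R.
Proof. by rewrite mcoeffB !mcoeffXn. Qed.

Lemma powers_diff_neq0 k i j : (0 < k)%N -> i != j ->
  'X_i ^+ k - 'X_j ^+ k != 0 :> {mpoly C[3]}.
Proof.
move=> k0 ij; apply/eqP => /mpolyP/(_ (U_(i) *+ k)%MM)/eqP.
rewrite coef_powers_diff mcoeff0 eqxx.
case: (_ =P (U_(i) *+ k)%MM) => [e|_]; last by rewrite subr0 oner_eq0.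
have := congr1 (fun m : 'X_{1..3} => m i) e.
by rewrite !mulmnE !mnm1E eqxx eq_sym (negPf ij); lia.
Qed.

Lemma mlead_powers_diff k i j l : (0 < k)%N -> i != j -> i != l -> j != l ->
  mlead ('X_i ^+ k - 'X_j ^+ k : {mpoly C[3]}) l = 0%N.
Proof.
move=> k0 ij il jl; have := mlead_supp (powers_diff_neq0 k0 ij).
rewrite mcoeff_msupp coef_powers_diff.
case: ((U_(i) *+ k)%MM =P _) => [<- _|_]; first by rewrite mulmnE mnm1E (negPf il).
case: ((U_(j) *+ k)%MM =P _) => [<- _|_]; first by rewrite mulmnE mnm1E (negPf jl).
by rewrite subrr eqxx.
Qed.

(** If [h^2] divides the curve, then [h] divides its partial derivatives, hence
    [X_i^(d-1) - X_j^(d-1)] for all [i] and [j].  The leading monomial of this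
    binomial does not involve the third variable; neither does that of [h],
    which therefore involves no variable at all. *)
Lemma curve_squarefree : squarefree f.
Proof.
move=> h [q e].
have h0 : h != 0.
  by apply: contraTneq curve_neq0 => h0; rewrite e h0 expr0n mulr0 eqxx.
have dvd_deriv i : divides h f^`M(i).
  rewrite e mderivM mderiv_exp expr2; apply: dividesD.
    by apply: divides_mull; exists h.
  by apply: divides_mull; exists (h^`M(i) *+ 2); rewrite expr1; ring.
have dvd_diff i j : divides h ('X_i ^+ d.-1 - 'X_j ^+ d.-1).
  have [qi ei] := dvd_deriv i; have [qj ej] := dvd_deriv j.
  exists ((d%:R^-1)%:MP * (qi - qj)); rewrite -mulrA mulrBl -ei -ej !curve_deriv //.
  have dE (x : {mpoly C[3]}) : x *+ d = d%:R%:MP * x by rewrite mpolyC_nat mulr_natl.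
  rewrite -mulrnBl dE [RHS]mulrA -mpolyCM mulVf ?d_neq0 // mul1r.
  by rewrite opprB addrA subrK.
apply: msize1_unit; rewrite -mlead_deg //.
suff -> : mlead h = 0%MM by rewrite mdeg0.
apply/mnmP => i; rewrite mnm0E; apply/eqP; rewrite -leqn0.
have ij : fst_of i != snd_of i by rewrite (inj_eq lift_inj).
have [q' e'] := dvd_diff (fst_of i) (snd_of i).
have := powers_diff_neq0 (d1_gt0 hd) ij.
rewrite e' mulf_eq0 negb_or => /andP[q0 _].
have li k : lift i k != i by rewrite eq_sym neq_lift.
have := mlead_powers_diff (d1_gt0 hd) ij (li _) (li _).
by rewrite e' mleadM // mnmDE => /eqP; rewrite addn_eq0 => /andP[_ /eqP ->].
Qed.

Lemma line_eval_fst i a b : (line C (fst_of i)).@[pt i a b 0] = a - b.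
Proof. by rewrite line_as_sum sum_pt pt_fst. Qed.

Lemma line_eval_snd i a b : (line C (snd_of i)).@[pt i a b 0] = a + b.
Proof. by rewrite line_as_sum sum_pt pt_snd opprK. Qed.

Lemma line_eval_other i j : j != i -> (line C j).@[pt i 1 0 0] = 1.
Proof.
move=> ji; case: (unliftP i j) ji => [k|] ->; last by rewrite eqxx.
by rewrite line_as_sum sum_pt mxE liftK oppr0 if_same subr0.
Qed.

Lemma lineNdvd i j : j != i -> ~ divides (line C i) (line C j).
Proof.
move=> ji [q e]; have := line_eval_other ji.
by rewrite e mevalM line_pt mulr0 => /esym/eqP; rewrite oner_eq0.
Qed.

Lemma lift_neq i : fst_of i != snd_of i.
Proof. by rewrite (inj_eq lift_inj). Qed.

Lemma linesE (T : comNzRingType) (F : 'I_3 -> T) i :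
  F i * (F (fst_of i) * F (snd_of i)) = F 0 * F 1 * F 2.
Proof.
have -> : F 0 * F 1 * F 2 = \prod_j F j.
  rewrite !big_ord_recl big_ord0 mulr1 mulrA.
  by congr (_ * F _ * F _); apply: val_inj.
rewrite (bigD1_ord i) //= !big_ord_recl big_ord0 mulr1.
by congr (_ * (_ * F (lift _ _))); apply: val_inj.
Qed.

(** The lines divide the curve one after the other: each linear form is prime and
    divides none of the other two. *)
Lemma residual_curve : exists g : {mpoly C[3]},
  forall i, line_cofactor C d i = line C (fst_of i) * line C (snd_of i) * g.
Proof.
have dvd i : divides (line C i) f.
  by exists (line_cofactor C d i); rewrite mulrC -curve_factor.
have step i j p : i != j -> divides (line C i) (line C j * p) -> divides (line C i) p.
  by move=> ij /(line_prime (lift_neq i)) [] // /lineNdvd []; rewrite eq_sym.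
have [p ep] : divides (line C 1) (line_cofactor C d 0).
  by apply: (step 1 0) => //; rewrite -curve_factor.
have [g eg] : divides (line C 2) p.
  apply: (step 2 1) => //; rewrite mulrC -ep; apply: (step 2 0) => //.
  by rewrite -curve_factor.
exists g => i.
have l0 : line C i != 0 by apply: line_neq0 (lift_neq i).
apply: (mulfI l0); rewrite -curve_factor // (curve_factor _ hodd 0) ep eg.
by rewrite [RHS]mulrA (linesE (line C)); ring.
Qed.

Section Residual.
Variable g : {mpoly C[3]}.
Hypothesis gE : forall i,
  line_cofactor C d i = line C (fst_of i) * line C (snd_of i) * g.

Lemma curve_lines : f = line C 2 * (line C 1 * (line C 0 * g)).
Proof. by rewrite (curve_factor _ hodd 0) gE [LHS]mulrA (linesE (line C)); ring. Qed.

Lemma residual_homog : g \is (d - 3).-homog.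
Proof.
have L0 : line C 0 * line C 1 * line C 2 != 0.
  by rewrite !mulf_neq0 ?line_neq0 ?lift_neq.
have Lh : line C 0 * line C 1 * line C 2 \is (1 + 1 + 1).-homog.
  by rewrite !dhomogM ?line_homog.
apply: (dhomog_divl L0 Lh); rewrite addnC subnK //.
suff -> : line C 0 * line C 1 * line C 2 * g = f by apply: curve_homog.
by rewrite curve_lines; ring.
Qed.

Lemma residual_eval i a b :
  (a - b) * (a + b) * g.@[pt i a b 0] = (b ^+ d.-1 - a ^+ d.-1) *+ d.
Proof. by rewrite -(cofactor_pt d i) gE !mevalM line_eval_fst line_eval_snd. Qed.

(** A product of two functions that vanish at a point has zero gradient there,
    which [cofactor_tangent] excludes. *)
Lemma cofactor_simple i u (p q : {mpoly C[3]}) : u ^+ d.-1 = 1 ->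
  line_cofactor C d i = p * q -> p.@[pt i 1 u 0] = 0 -> q.@[pt i 1 u 0] = 0 -> False.
Proof.
move=> ue e p0 q0; have := cofactor_tangent hd hodd i ue; rewrite e !mderivM.
by rewrite !mevalD !mevalM p0 q0 !mul0r !mulr0 eqxx.
Qed.

(** A singular point of [g] is singular on the curve, so it is some [pt i 1 u] up
    to scaling; as [g] divides the cofactor of line [i], the gradient of this
    cofactor would vanish there. *)
Lemma residual_smooth v : (3 < d)%N -> v != 0 -> g.@[v 0] = 0 ->
  (forall i, g^`M(i).@[v 0] = 0) -> False.
Proof.
move=> d3 v0 gv dg.
have dv i : f^`M(i).@[v 0] = 0.
  by rewrite (curve_factor _ hodd 0) gE mulrA mderivM mevalD !mevalM gv dg !mulr0 addr0.
have [i [u [c [ue c0 vE]]]] := singular_vector hd v0 dv.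
have hz (p : {mpoly C[3]}) k : p \is k.-homog -> p.@[v 0] = 0 -> p.@[pt i 1 u 0] = 0.
  move=> hp; have -> : p.@[v 0] = p.@[fun j => c * pt i 1 u 0 j].
    by apply: meval_eq => j; rewrite vE mxE.
  rewrite (dhomog_scale _ _ hp) => /eqP.
  by rewrite mulf_eq0 expf_eq0 (negPf c0) andbF => /eqP.
have gp := hz _ _ residual_homog gv.
have dgp j : g^`M(j).@[pt i 1 u 0] = 0.
  apply: (hz _ (d - 4)%N _ (dg j)); apply: dhomog_deriv.
  by rewrite -subSn // subSS residual_homog.
have := cofactor_tangent hd hodd i ue; rewrite gE ![(_ * g)^`M(_)]mderivM.
by rewrite !mevalD !mevalM gp !dgp !mulr0 eqxx.
Qed.

(** For [u] equal to 1 or -1, the point lies on a second line, so that the product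
    of the other two lines already vanishes there. *)
Lemma residual_vertex i u : u ^+ 2 = 1 -> g.@[pt i 1 u 0] != 0.
Proof.
move=> u2; have ue : u ^+ d.-1 = 1.
  have := odd_double_half d; rewrite hodd => <-.
  by rewrite /= -mul2n exprM u2 expr1n.
apply/eqP => gp; apply: (@cofactor_simple i u _ _ ue (gE i)) gp.
by rewrite mevalM line_eval_fst line_eval_snd mulrDr mulr1 mulrBl mul1r -expr2 u2; ring.
Qed.

(** Write [s] for [x + y].  The curve is [x^d + y^d - ((z + s)^d - z^d)], so its
    quotient by [s] has leading coefficient [- d] in [z]. *)
Lemma lead_coef_residual : lead_coef (poly_in_z g) \is a GRing.unit.
Proof.
suff : lead_coef (poly_in_z (line_cofactor C d 2)) \is a GRing.unit.
  by rewrite gE poly_in_zM lead_coefM unitrM => /andP[].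
have nunit : (d%:R : {poly {poly C}}) \is a GRing.unit.
  rewrite -(rmorph_nat (polyC \o polyC : {rmorphism C -> {poly {poly C}}})).
  by rewrite rmorph_unit // unitfE d_neq0.
pose Phi : {rmorphism {mpoly C[3]} -> {poly {poly {poly C}}}} :=
  mmap (polyC \o (polyC \o polyC)) (fun i => [:: 'X%:P; 'X%:P%:P; 'X]`_i).
have PhiX i : Phi 'X_i = [:: 'X%:P; 'X%:P%:P; 'X]`_i by rewrite /Phi /= mmapX mmap1U.
rewrite -[poly_in_z _]/(Phi _) rmorphB !rmorph_geom rmorphN rmorph_sum.
rewrite (sum_around _ 2) !PhiX /= -polyCD -polyCN -rmorph_geom.
rewrite lead_coef_geom_shift ?unitrN ?(leq_trans _ hd) //.
by apply: contraTneq nunit => ->; rewrite unitr0.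
Qed.

End Residual.
End Reduced.

(** * The irreducible components *)

Section Components.
Variables (C : numClosedFieldType) (d : nat).
Hypotheses (hd : (3 <= d)%N) (hodd : odd d).
Implicit Types (v w : 'rV[C]_3) (a b c u : C) (i j : 'I_3) (P : P2 C).
Local Notation f := (curveV C d).

Lemma three_linesE : three_lines C = [:: line C 2; line C 1; line C 0].
Proof.
rewrite /three_lines /line /varx /vary /varz.
by congr [:: 'X__ + 'X__; 'X__ + 'X__; 'X__ + 'X__]; apply: val_inj.
Qed.

Lemma three_linesP l : l \in three_lines C -> exists i, l = line C i.
Proof.
rewrite three_linesE !inE => /or3P[] /eqP ->; by [exists 2|exists 1|exists 0].
Qed.

Variable g : {mpoly C[3]}.
Hypothesis gE : forall i,
  line_cofactor C d i = line C (fst_of i) * line C (snd_of i) * g.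

Lemma residual_irreducible : (3 < d)%N -> irreducible g.
Proof.
move=> d3; apply: (nonsingular_irreducible _ (residual_homog hd hodd gE)).
- by rewrite subn_gt0.
- exact: lead_coef_residual gE.
- by move=> v; apply: residual_smooth gE _ _.
Qed.

Lemma residual_smooth_curve : (3 < d)%N -> smooth_curve g.
Proof.
move=> d3 P; have [v v0 eP] := P2_coords P.
have hg : g \is (d - 4).+1.-homog by rewrite -subSn // subSS (residual_homog hd hodd gE).
move/(singular_coords hg eP) => [gv dg].
exact: (residual_smooth hd hodd gE d3 v0 gv dg).
Qed.

Lemma residual_corner i : g.@[pt i 1 0 0] != 0.
Proof.
have := residual_eval gE i 1 0; rewrite subr0 addr0 !mul1r => ->.
by rewrite expr0n eqn0Ngt (d1_gt0 hd) expr1n sub0r mulNrn oppr_eq0 d_neq0.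
Qed.

Lemma line_not_same i (h : {mpoly C[3]}) : h.@[pt i 1 0 0] != 0 ->
  ~ same_curve (line C i) h /\ ~ same_curve h (line C i).
Proof.
move=> hp; split=> -[c c0 e]; move: hp.
  have /eqP := line_pt i (1 : C) 0; rewrite e mevalZ mulf_eq0 (negPf c0) /=.
  by move=> ->.
by rewrite e mevalZ line_pt mulr0 eqxx.
Qed.

(** The linear forms are split off one by one from a multiple of [h]; what remains
    is [g], which is irreducible.  Evaluation at [pt i 1 0], which lies on line [i]
    only, tells the four components apart. *)
Lemma curve_components : (3 < d)%N -> irr_components f (rcons (three_lines C) g).
Proof.
move=> d3; have ig := residual_irreducible d3.
have il i : irreducible (line C i) by apply: line_irreducible (lift_neq i).
have fE := curve_lines hodd gE.
rewrite three_linesE /=; split.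
  have ll i j : i != j -> ~ same_curve (line C i) (line C j).
    move=> ij; apply: (line_not_same _).1.
    by rewrite line_eval_other ?oner_neq0 // eq_sym.
  have lg i : ~ same_curve (line C i) g /\ ~ same_curve g (line C i).
    exact: line_not_same (residual_corner i).
  have lg1 i := (lg i).1; have lg2 i := (lg i).2.
  case=> [[|[|[|[|i]]]] Hi] // [[|[|[|[|j]]]] Hj] //= sc; try exact: val_inj;
    by [case: (ll _ _ _ sc) | case: (lg1 _ sc) | case: (lg2 _ sc)].
move=> h; split.
  move=> [ih]; rewrite fE.
  case/(irreducible_divides_line_mul (lift_neq 2) ih) => [sh|].
    by exists (line C 2); rewrite ?inE ?eqxx.
  case/(irreducible_divides_line_mul (lift_neq 1) ih) => [sh|].
    by exists (line C 1); rewrite ?inE ?eqxx ?orbT.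
  case/(irreducible_divides_line_mul (lift_neq 0) ih) => [sh|].
    by exists (line C 0); rewrite ?inE ?eqxx ?orbT.
  move/(irreducible_divides_irreducible ih ig) => sh.
  by exists g; rewrite ?inE ?eqxx ?orbT.
case=> k; rewrite !inE => ks sh.
suff [ik kf] : irreducible k /\ divides k f.
  by split; [apply: same_curve_irreducible sh ik | apply: same_curve_divides sh kf].
rewrite fE; case/or4P: ks => /eqP ->; split=> //.
- by apply: divides_mulr; exists 1; rewrite mul1r.
- by apply: divides_mull; apply: divides_mulr; exists 1; rewrite mul1r.
- by do 2!apply: divides_mull; apply: divides_mulr; exists 1; rewrite mul1r.
- by do 3!apply: divides_mull; exists 1; rewrite mul1r.
Qed.

(** On line [i], [(a - b) (a + b) g] is [d (b^(d-1) - a^(d-1))] by [residual_eval],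
    and the roots [1] and [-1] of the right-hand side belong to the vertices. *)
Lemma line_residual_points P i : on_curve (line C i) P /\ on_curve g P <->
  exists u, [/\ u ^+ d.-1 = 1, u != 1, u != -1 & val P = vline (pt i 1 u)].
Proof.
have hl : line C i \is 1.-homog by apply: line_homog.
have hg := residual_homog hd hodd gE.
split.
  have [v v0 eP] := P2_coords P.
  case=> /(on_curve_coords hl eP) lv /(on_curve_coords hg eP) gv.
  have vE := on_line_pt lv; move: gv; rewrite vE => gv.
  set a := v 0 i in vE gv; set b := v 0 (fst_of i) in vE gv.
  have := residual_eval gE i a b; rewrite gv mulr0 => /esym/eqP.
  rewrite mulrn_eq0 subr_eq0 => /orP[|/eqP ab]; first by case: (d) hd.
  have a0 : a != 0.
    apply: contraNneq v0 => a0; move/eqP: ab.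
    rewrite a0 expr0n eqn0Ngt (d1_gt0 hd) expf_eq0 => /andP[_ /eqP b0].
    rewrite vE a0 b0; apply/eqP/rowP => j; rewrite !mxE.
    by case: unlift => // k; rewrite oppr0 if_same.
  have vE' : v = a *: pt i 1 (b / a) by rewrite pt_scale mulr1 mulrCA divff // mulr1.
  have gu : g.@[pt i 1 (b / a) 0] = 0.
    have eP' : val P = vline (pt i 1 (b / a)) by rewrite eP vE' line_scale.
    by apply/(on_curve_coords hg eP')/(on_curve_coords hg eP); rewrite vE.
  exists (b / a); split.
  - by rewrite expr_div_n ab divff // expf_neq0.
  - apply: contra_eq_neq gu => ->; apply: (residual_vertex hd hodd gE).
    by rewrite expr1n.
  - apply: contra_eq_neq gu => ->; apply: (residual_vertex hd hodd gE).
    by rewrite sqrrN expr1n.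
  - by rewrite eP vE' line_scale.
move=> [u [ue u1 um1 eP]]; split.
  by apply/(on_curve_coords hl eP); rewrite line_pt.
apply/(on_curve_coords hg eP); have /eqP := residual_eval gE i 1 u.
rewrite ue expr1n subrr mul0rn !mulf_eq0 subr_eq0 eq_sym (negPf u1) /=.
by rewrite addrC addr_eq0 (negPf um1) => /eqP.
Qed.

Lemma line_residual_count i :
  has_exactly (d - 3)%N (fun P => on_curve (line C i) P /\ on_curve g P).
Proof.
have [rs [urs srs rsE]] := unity_roots C hd.
apply: (@has_exactly_points _ _ [seq u <- rs | (u != 1) && (u != -1)] (pt i 1)).
- by rewrite filter_uniq.
- rewrite size_filter_neq2 // ?one_neq_m1 // ?rsE ?(even_pow hd hodd) ?expr1n //.
  by rewrite srs; lia.
- exact: pt_neq0.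
- by move=> u w _ _ /pt_line_inj.
move=> P; rewrite line_residual_points; split.
  move=> [u [ue u1 um1 eP]]; exists u => //.
  by rewrite mem_filter u1 um1 rsE ue eqxx.
case=> u; rewrite mem_filter rsE => /andP[/andP[u1 um1] /eqP ue] eP.
by exists u; split.
Qed.

(** A second line meets line [i] at the parameter 1 or -1, excluded by
    [line_residual_points]. *)
Lemma residual_avoids_vertices P : on_curve g P -> ~ triangle_vertex P.
Proof.
move=> gP [_ [_ [/three_linesP[i ->] /three_linesP[j ->] ij iP jP]]].
have [u [_ u1 um1 eP]] := (line_residual_points P i).1 (conj iP gP).
have := jP (pt i 1 u); rewrite eP memv_line => /(_ isT) /eqP.
case: (unliftP i j) ij => [k|] -> //; last by rewrite eqxx.
move=> _; rewrite line_as_sum sum_pt mxE liftK subr_eq0.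
by case: ifP => _; rewrite eq_sym ?eqr_oppLR ?(negPf u1) ?(negPf um1).
Qed.

End Components.

Theorem proposition3p8 (R : realType) (d : nat) (hd : (3 <= d)%N)
    (hodd : odd d) :
  let C := Cplx R in
  let f := curveV C d in
  [/\ reduced_plane_curve d f,
      has_exactly (3 * (d - 2))%N (singular_at f),
      (forall P : P2 C, singular_at f P -> type_A1_at f P),
      (forall P : P2 C, singular_at f P <->
         exists u : C, u ^+ (d - 1) = 1 /\
           [\/ has_coords P 1 u (- u),
               has_coords P u 1 (- u) |
               has_coords P u (- u) 1]) &
      ((5 <= d)%N ->
       exists g : {mpoly C[3]},
         [/\ g \is (d - 3).-homog,
             smooth_curve g,
             irr_components f (rcons (three_lines C) g),
             (forall l, l \in three_lines C ->
                has_exactly (d - 3)%N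
                  (fun P : P2 C => on_curve l P /\ on_curve g P)) &
             (forall P : P2 C, on_curve g P -> ~ triangle_vertex P)])].
Proof.
move=> C; clearbody C => f; split.
- by split; [exact: curve_neq0 | exact: curve_homog | exact: curve_squarefree].
- exact: singular_count.
- exact: singular_A1.
- move=> P; rewrite singular_atP // subn1; split.
    move=> [i [u [ue eP]]]; exists u; split=> //; rewrite /has_coords eP.
    have [p0 p1 p2] := pt_vec3 u.
    by case: (ord3P i) => ->; [rewrite p0|rewrite p1|rewrite p2];
      [constructor 1|constructor 2|constructor 3].
  move=> [u [ue hP]]; have [p0 p1 p2] := pt_vec3 u.
  by case: hP => eP; [exists 0; exists u | exists 1; exists u | exists 2; exists u];
    rewrite ?p0 ?p1 ?p2.
move=> d5; have [g gE] := residual_curve C hodd.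
have d3 : (3 < d)%N by apply: leq_trans d5.
exists g; split.
- exact: residual_homog gE.
- exact: residual_smooth_curve gE d3.
- exact: curve_components gE d3.
- by move=> l /three_linesP[i ->]; apply: line_residual_count gE i.
- exact: (residual_avoids_vertices hd hodd gE).
Qed.
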